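(* Let $G=(V,E)$ be a finite undirected graph with $n=|V|$, let $d:E\to\mathbb{R}^+$, let $k,\alpha\ge 2$ be integers, and put $\beta=n-(k-1)\alpha$. Let $i,j\in V$ be such that $\mathsf{d_p}(i,j)\ge\beta$, where $\mathsf{d_p}(i,j)$ is the minimum length (number of edges) of a path between $i$ and $j$ in $G$. Then the inequalities $$y_i^c+y_j^c\le 1,\qquad \forall c\in[k],$$ are valid for the model $(\mathcal{M}_1)$ and for the model $(\mathcal{M}_2)$.
   Context: Notation: $V=\{1,\dots,n\}$, $[k]=\{1,\dots,k\}$, $\bar E=\{\{i,j\}\notin E: i,j\in V, i\ne j\}$. If no path joins $i$ and $j$ then $\mathsf{d_p}(i,j)=\infty$. An (in)equality is valid for a model if every feasible solution of the model satisfies it. Each edge $\{i,j\}$ has two associated antiparallel arcs $(i,j)$, $(j,i)$; $\delta^-_j$ and $\delta^+_j$ are the sets of arcs entering and leaving node $j$. Variables indexed by edges are symmetric ($x_{ij}=x_{ji}$); flow variables are indexed by arcs. Both models describe partitions of $V$ into $k$ sets $V_1,\dots,V_k$ (with $y_i^c=1$ iff $i\in V_c$), each inducing a connected subgraph and having at least $\alpha$ nodes, minimizing the total cost of edges with both ends in the same set. Model $(\mathcal{M}_1)$: variables $y_i^c\in\{0,1\}$ ($i\in V,c\in[k]$), $x_{ij}^c\in\{0,1\}$ ($\{i,j\}\in E,c\in[k]$), $\bar x_{ij}^c\in\{0,1\}$ ($\{i,j\}\in\bar E,c\in[k]$), and $f_{ij}^{lc}\ge 0$ real for both arcs $(i,j)$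 of each edge of $E$, $l\in V$, $c\in[k]$. Minimize $\sum_{c\in[k]}\sum_{\{i,j\}\in E}d_{ij}x_{ij}^c$ subject to: (1) $\sum_{c\in[k]}y_i^c=1$ for all $i\in V$; (2) $y_i^c+y_j^c-x_{ij}^c\le1$ and $y_i^c+y_j^c-2x_{ij}^c\ge0$ for all $\{i,j\}\in E$, $c\in[k]$; (3) $y_i^c+y_j^c-\bar x_{ij}^c\le1$ and $y_i^c+y_j^c-2\bar x_{ij}^c\ge0$ for all $\{i,j\}\in\bar E$, $c\in[k]$; (4) $\sum_{l\in V}(f_{ij}^{lc}+f_{ji}^{lc})\le 2nk\,x_{ij}^c$ for all $\{i,j\}\in E$, $c\in[k]$; (5) for all $(l,j)\in V\times V$, $c\in[k]$: $\sum_{(i,j)\in\delta^-_j}f_{ij}^{lc}-\sum_{(j,i)\in\delta^+_j}f_{ji}^{lc}$ equals $-\sum_{i:\{j,i\}\in\bar E}\bar x_{ji}^c$ if $j=l$, equals $0$ if $\{l,j\}\in E$, and equals $\bar x_{lj}^c$ otherwise; (6) $\sum_{i\in V}y_i^c\ge\alpha$ for all $c\in[k]$. Model $(\mathcal{M}_2)$: let $\mathbb{A}=\{n+1,\dots,n+k\}$ be artificial nodes and $E^k=E\cup\{\{i,j\}:i\in V,j\in\mathbb{A}\}$; arcs and the sets $\delta^\pm_j$ refer to the graph $(V\cup\mathbb{A},E^k)$. Variables $y_i^c\in\{0,1\}$ ($i\in V,c\in[k]$), $x_{ij}\in\{0,1\}$ ($\{i,j\}\in E^k$), and $f_{ij}\ge0$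 real for both arcs of each edge of $E^k$. Minimize $\sum_{\{i,j\}\in E}d_{ij}x_{ij}$ subject to: (1) $\sum_{c\in[k]}y_i^c=1$ for all $i\in V$; (2) $y_i^c+y_j^c-x_{ij}\le1$ for all $\{i,j\}\in E$, $c\in[k]$; (3) $y_i^c+y_j^\ell+x_{ij}\le2$ for all $\{i,j\}\in E$, $c,\ell\in[k]$, $c\ne\ell$; (4) $\sum_{j\in V}x_{ij}=1$ and $\sum_{j\in V}f_{ij}=\sum_{j\in V}y_j^{i-n}$ for all $i\in\mathbb{A}$; (5) $\sum_{(i,j)\in\delta^-_j}f_{ij}-\sum_{(j,i)\in\delta^+_j}f_{ji}=1$ for all $j\in V$; (6) $f_{ij}+f_{ji}\le\beta x_{ij}$ for all $\{i,j\}\in E$; (7) $\alpha x_{ij}\le f_{ij}\le\beta x_{ij}$ for all $i\in\mathbb{A}$, $j\in V$. *)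

(* Defs.v *)
From HB Require Import structures.
From mathcomp Require Import all_boot all_order all_algebra.
From mathcomp Require Import all_classical all_reals all_analysis.
Set Implicit Arguments.
Unset Strict Implicit.
Unset Printing Implicit Defensive.
Import Order.TTheory GRing.Theory Num.Theory.
Local Open Scope ring_scope.

(* An edge is a two-element set of nodes, so the nodes 1, ..., n are the
   elements of 'I_n and a family indexed by edges is a function on
   {set 'I_n}: it is symmetric by construction, and its values outside the
   intended index set occur in no constraint and no objective. *)

Definition edge_set (T : finType) (E : {set {set T}}) : Prop :=
  forall A, A \in E -> #|A| = 2%N.

Definition non_edges (T : finType) (E : {set {set T}}) : {set {set T}} :=
  [set A : {set T} | (#|A| == 2%N) && (A \notin E)].

Definition adj (T : finType) (E : {set {set T}}) : rel T :=
  fun i j => [set i; j] \in E.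

(* The path visits i :: p, hence has [size p] edges. *)
Definition graph_path (T : finType) (E : {set {set T}}) (i j : T) (p : seq T)
  : Prop := [/\ path (adj E) i p, uniq (i :: p) & last i p = j].

(* The infimum of the empty set is +oo, the value when no path joins i and j;
   otherwise it is a minimum, path lengths being natural numbers. *)
Definition path_dist (R : realType) (T : finType) (E : {set {set T}})
  (i j : T) : \bar R :=
  ereal_inf [set ((size p)%:R)%:E | p in graph_path E i j]%classic.

(* Subtraction in R, not truncated: the value may be negative. *)
Definition beta (R : realType) (n k alpha : nat) : R :=
  n%:R - (k%:R - 1) * alpha%:R.

Record min_model (R : realType) := MinModel {
  solution : Type;
  feasible : solution -> Prop;
  objective : solution -> R }.

Definition valid (R : realType) (M : min_model R) (P : solution M -> Prop)
  : Prop := forall s : solution M, feasible s -> P s.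

Definition net_inflow (R : realType) (T : finType) (E : {set {set T}})
  (f : T -> T -> R) (j : T) : R :=
  \sum_(i | [set i; j] \in E) f i j - \sum_(i | [set j; i] \in E) f j i.

(* [m1_f s l c i j] is the flow f_{ij}^{lc} on the arc (i, j). *)
Record M1_solution (R : realType) (n k : nat) := M1Solution {
  m1_y : 'I_n -> 'I_k -> bool;
  m1_x : {set 'I_n} -> 'I_k -> bool;
  m1_xbar : {set 'I_n} -> 'I_k -> bool;
  m1_f : 'I_n -> 'I_k -> 'I_n -> 'I_n -> R }.

Record M1_feasible (R : realType) (n k alpha : nat) (E : {set {set 'I_n}})
  (s : M1_solution R n k) : Prop := M1Feasible {
  m1_flow_ge0 : forall l c i j, [set i; j] \in E -> 0 <= m1_f s l c i j;
  m1_assign : forall i, \sum_(c < k) (m1_y s i c)%:R = 1 :> R;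
  m1_edge : forall i j c, [set i; j] \in E ->
    (m1_y s i c)%:R + (m1_y s j c)%:R - (m1_x s [set i; j] c)%:R <= 1 :> R /\
    (m1_y s i c)%:R + (m1_y s j c)%:R - 2 * (m1_x s [set i; j] c)%:R >= 0 :> R;
  m1_non_edge : forall i j c, [set i; j] \in non_edges E ->
    (m1_y s i c)%:R + (m1_y s j c)%:R - (m1_xbar s [set i; j] c)%:R
      <= 1 :> R /\
    (m1_y s i c)%:R + (m1_y s j c)%:R - 2 * (m1_xbar s [set i; j] c)%:R
      >= 0 :> R;
  m1_capacity : forall i j c, [set i; j] \in E ->
    \sum_(l < n) (m1_f s l c i j + m1_f s l c j i)
      <= (2 * n * k)%:R * (m1_x s [set i; j] c)%:R;
  m1_balance : forall l j c,
    net_inflow E (m1_f s l c) j =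
      if j == l then
        - \sum_(i | [set j; i] \in non_edges E) (m1_xbar s [set j; i] c)%:R
      else if [set l; j] \in E then 0
      else (m1_xbar s [set l; j] c)%:R;
  m1_size : forall c, \sum_(i < n) (m1_y s i c)%:R >= alpha%:R :> R }.

Definition M1 (R : realType) (n : nat) (E : {set {set 'I_n}})
  (d : {set 'I_n} -> R) (k alpha : nat) : min_model R :=
  @MinModel R (M1_solution R n k) (M1_feasible alpha E)
    (fun s => \sum_(c < k) \sum_(A in E) d A * (m1_x s A c)%:R).

(* In 'I_(n + k) the first n elements are the original nodes and the last k
   the artificial ones; [rshift n c] is the artificial node of class c. *)
Definition vnode (n k : nat) (i : 'I_n) : 'I_(n + k) := lshift k i.
Definition anode (n k : nat) (c : 'I_k) : 'I_(n + k) := rshift n c.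

Definition ext_edges (n k : nat) (E : {set {set 'I_n}})
  : {set {set 'I_(n + k)}} :=
  [set @vnode n k @: A | A : {set 'I_n} in E] :|:
  [set [set vnode k i; anode n c] | i : 'I_n, c : 'I_k].

Record M2_solution (R : realType) (n k : nat) := M2Solution {
  m2_y : 'I_n -> 'I_k -> bool;
  m2_x : {set 'I_(n + k)} -> bool;
  m2_f : 'I_(n + k) -> 'I_(n + k) -> R }.

Record M2_feasible (R : realType) (n k alpha : nat) (E : {set {set 'I_n}})
  (s : M2_solution R n k) : Prop := M2Feasible {
  m2_flow_ge0 : forall u v, [set u; v] \in ext_edges k E -> 0 <= m2_f s u v;
  m2_assign : forall i, \sum_(c < k) (m2_y s i c)%:R = 1 :> R;
  m2_same_class : forall i j c, [set i; j] \in E ->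
    (m2_y s i c)%:R + (m2_y s j c)%:R
      - (m2_x s [set vnode k i; vnode k j])%:R <= 1 :> R;
  m2_diff_class : forall i j c l, [set i; j] \in E -> c != l ->
    (m2_y s i c)%:R + (m2_y s j l)%:R
      + (m2_x s [set vnode k i; vnode k j])%:R <= 2 :> R;
  m2_root : forall c,
    \sum_(j < n) (m2_x s [set anode n c; vnode k j])%:R = 1 :> R;
  m2_supply : forall c,
    \sum_(j < n) m2_f s (anode n c) (vnode k j)
      = \sum_(j < n) (m2_y s j c)%:R;
  m2_balance : forall j, net_inflow (ext_edges k E) (m2_f s) (vnode k j) = 1;
  m2_capacity : forall i j, [set i; j] \in E ->
    m2_f s (vnode k i) (vnode k j) + m2_f s (vnode k j) (vnode k i)
      <= beta R n k alpha * (m2_x s [set vnode k i; vnode k j])%:R;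
  m2_root_flow : forall c j,
    alpha%:R * (m2_x s [set anode n c; vnode k j])%:R
      <= m2_f s (anode n c) (vnode k j)
      <= beta R n k alpha * (m2_x s [set anode n c; vnode k j])%:R }.

Definition M2 (R : realType) (n : nat) (E : {set {set 'I_n}})
  (d : {set 'I_n} -> R) (k alpha : nat) : min_model R :=
  @MinModel R (M2_solution R n k) (M2_feasible alpha E)
    (fun s => \sum_(A in E) d A * (m2_x s (@vnode n k @: A))%:R).

(* Main.v *)
(* Each of the k classes has at least alpha nodes, so none has more than beta.
   In both models the flow constraints force every class to induce a connected
   subgraph: two nodes of a class are then joined by a simple path inside the
   class, which has fewer than beta edges.  In M1, a component of class c that
   avoids a node i of the class receives no flow of commodity i, although each of
   its nodes demands one unit.  In M2, every component of a class demands flow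
   from a root; there are k nonempty classes and k roots, each root being
   attached to a single node, so every class has one component. *)

Require Import Defs.
From HB Require Import structures.
From mathcomp Require Import all_boot all_order all_algebra.
From mathcomp Require Import all_classical all_reals all_analysis.
Import Order.TTheory GRing.Theory Num.Theory.
Local Open Scope ring_scope.

Set Implicit Arguments.
Unset Strict Implicit.
Unset Printing Implicit Defensive.

(** The components of this one relation are exactly the components of the subgraphs induced by the
    classes, for all classes at once. *)
Definition class_adj (T C : finType) (E : {set {set T}}) (cl : T -> C) : rel T :=
  fun u v => adj E u v && (cl u == cl v).

Lemma class_adj_sym (T C : finType) (E : {set {set T}}) (cl : T -> C) :
  symmetric (class_adj E cl).
Proof. by move=> u v; rewrite /class_adj /adj finset.setUC eq_sym. Qed.

Lemma connect_class_adj (T C : finType) (E : {set {set T}}) (cl : T -> C) u v :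
  connect (class_adj E cl) u v -> cl u = cl v.
Proof.
move=> /connectP[p pP ->]; elim: p u pP => //= w p IHp u /andP[/andP[_ /eqP ->]].
exact: IHp.
Qed.

(** An arc with both ends in [S] counts once as inflow and once as outflow, so only arcs across the
    cut survive. *)
Lemma sum_net_inflow (R : realType) (T : finType) (E : {set {set T}})
    (f : T -> T -> R) (S : {set T}) :
  \sum_(v in S) net_inflow E f v =
  \sum_(v in S) \sum_(u | ([set u; v] \in E) && (u \notin S)) (f u v - f v u).
Proof.
have netE v : net_inflow E f v = \sum_(u | [set u; v] \in E) (f u v - f v u).
  rewrite /net_inflow sumrB; congr (_ - _).
  by apply: eq_bigl => u; rewrite finset.setUC.
under eq_bigr => v _ do rewrite netE (bigID (mem S)) /=.
rewrite big_split /= -[RHS]add0r; congr (_ + _).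
under eq_bigr => v _ do rewrite sumrB.
rewrite sumrB (exchange_big_dep (mem S)) /=; last by move=> v u _ /andP[].
apply/eqP; rewrite subr_eq0; apply/eqP/eq_bigr => v vS.
by apply: eq_bigl => u; rewrite vS andbT finset.setUC andbC.
Qed.

Lemma sum_indicator_eq1 (R : realType) (T : finType) (b : pred T) :
  \sum_x (b x)%:R = 1 :> R -> exists x0, b =1 pred1 x0.
Proof.
rewrite -natr_sum => /eqP; rewrite pnatr_eq1 -big_mkcond sum1_card.
by move=> /fintype.card1P[x0 bE]; exists x0 => x; have := bE x; rewrite !inE.
Qed.

Lemma class_map (R : realType) (n k : nat) (y : 'I_n -> 'I_k -> bool) :
  (forall i, \sum_(c < k) (y i c)%:R = 1 :> R) ->
  exists cl : 'I_n -> 'I_k, forall i c, y i c = (cl i == c).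
Proof.
move=> y1; have /choice[cl clE] i := sum_indicator_eq1 (y1 i).
by exists cl => i c; rewrite clE /= eq_sym.
Qed.

(** The other [k - 1] classes already use at least [(k - 1) * alpha] of the [n] nodes. *)
Lemma class_card_le (R : realType) (n k alpha : nat) (cl : 'I_n -> 'I_k) (c : 'I_k) :
  (forall c', alpha <= #|[set v | cl v == c']|)%N ->
  #|[set v | cl v == c]|%:R <= beta R n k alpha.
Proof.
move=> cl_ge.
have card_n : n = (\sum_c' #|[set v | cl v == c']|)%N.
  rewrite -[LHS]card_ord -sum1_card (partition_big cl predT) //=.
  by apply: eq_bigr => c' _; rewrite -sum1_card; apply: eq_bigl => v; rewrite inE.
have k_gt0 : (0 < k)%N by apply: leq_ltn_trans (ltn_ord c).
have le_n : (#|[set v | cl v == c]| + k.-1 * alpha <= n)%N.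
  rewrite [X in (_ <= X)%N]card_n (bigD1 c) //= leq_add2l.
  have -> : (k.-1 * alpha = \sum_(c' < k | c' != c) alpha)%N.
    by rewrite sum_nat_const cardC1 card_ord.
  by apply: leq_sum.
have k1 : k%:R - 1 = k.-1%:R :> R by rewrite -{1}(prednK k_gt0) -natr1 addrK.
rewrite /beta k1 lerBrDr -natrM -natrD.
by rewrite ler_nat.
Qed.

Lemma connected_class_dist (R : realType) (n k alpha : nat)
    (E : {set {set 'I_n}}) (cl : 'I_n -> 'I_k) (i j : 'I_n) :
  (forall c', alpha <= #|[set v | cl v == c']|)%N ->
  connect (class_adj E cl) i j ->
  (path_dist R E i j < (beta R n k alpha)%:E)%E.
Proof.
move=> cl_ge /connectP[p0 p0P jE].
case: (shortenP p0P) jE => p pP p_uniq _ jE.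
have p_class v : v \in i :: p -> cl v == cl i.
  by move=> /(path_connect pP)/connect_class_adj ->.
(* A simple path has one more node than edges; this makes the final inequality strict. *)
have size_lt : ((size p).+1 <= #|[set v | cl v == cl i]|)%N.
  rewrite -[(size p).+1]/(size (i :: p)) -(card_uniqP p_uniq).
  by apply/subset_leq_card/fintype.subsetP => v /p_class; rewrite inE.
apply: (@le_lt_trans _ _ (size p)%:R%:E).
  apply: ereal_inf_lbound; exists p => //; split=> //.
  by apply: sub_path pP => u v /andP[].
rewrite lte_fin; apply: lt_le_trans (class_card_le R (cl i) cl_ge).
by rewrite ltr_nat.
Qed.

Lemma card_class (R : realType) (n k : nat) (y : 'I_n -> 'I_k -> bool)
    (cl : 'I_n -> 'I_k) (c : 'I_k) :
  (forall v c', y v c' = (cl v == c')) ->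
  \sum_(v < n) (y v c)%:R = #|[set v | cl v == c]|%:R :> R.
Proof.
move=> yE; rewrite -natr_sum -sum1_card [in RHS]big_mkcond /=; congr (_%:R).
by apply: eq_bigr => v _; rewrite inE yE.
Qed.

Lemma M1_class_connected (R : realType) (n k alpha : nat) (E : {set {set 'I_n}})
    (s : M1_solution R n k) (cl : 'I_n -> 'I_k) (i j : 'I_n) :
  M1_feasible alpha E s -> (forall v c, m1_y s v c = (cl v == c)) ->
  cl i = cl j -> connect (class_adj E cl) i j.
Proof.
move=> sP yE cl_ij; apply: contraT => nij.
have csym : connect_sym (class_adj E cl) by apply/sym_connect_sym/class_adj_sym.
pose S := [set v | connect (class_adj E cl) j v].
pose f := m1_f s i (cl i).
have iS : i \notin S by rewrite inE csym.
have clS v : v \in S -> cl v = cl i.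
  by rewrite inE cl_ij => /connect_class_adj.
(* An edge across the cut changes class, since otherwise [u] would lie in the component [S]. Hence
   its [x] is 0, and the capacity bound kills the flow of every commodity on it. *)
have cut0 u v : [set u; v] \in E -> u \notin S -> v \in S -> f u v - f v u = 0.
  move=> uvE uS vS.
  have clu : cl u != cl i.
    apply: contraNneq uS => clu; have clv := clS v vS; rewrite !inE in vS *.
    apply: connect_trans vS (connect1 _).
    by rewrite class_adj_sym /class_adj /adj uvE clu clv eqxx.
  have x0 : m1_x s [set u; v] (cl i) = false.
    have [_] := m1_edge sP (cl i) uvE.
    rewrite !yE (negPf clu) (clS v vS) eqxx.
    by case: m1_x => //; rewrite add0r mulr1 subr_ge0 lern1.
  have := m1_capacity sP (cl i) uvE; rewrite x0 mulr0 => cap.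
  have vuE : [set v; u] \in E by rewrite finset.setUC.
  have ge0 l : 0 <= m1_f s l (cl i) u v + m1_f s l (cl i) v u.
    by rewrite addr_ge0 ?(m1_flow_ge0 sP).
  have /eqP : \sum_(l < n) (m1_f s l (cl i) u v + m1_f s l (cl i) v u) = 0.
    by apply/eqP; rewrite eq_le cap sumr_ge0.
  rewrite psumr_eq0 // => /allP /(_ i (mem_index_enum _)).
  rewrite /= paddr_eq0 ?(m1_flow_ge0 sP) // => /andP[/eqP fuv /eqP fvu].
  by rewrite /f fuv fvu subrr.
have inflow0 : \sum_(v in S) net_inflow E f v = 0.
  rewrite sum_net_inflow big1 // => v vS; rewrite big1 // => u /andP[uvE uS].
  exact: cut0.
(* The node [v] is neither [i] nor adjacent to [i], so its demand is the [xbar] of a non-edge; both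
   ends lie in class [cl i], which forces that value to 1. *)
have inflow1 v : v \in S -> net_inflow E f v = 1.
  move=> vS; rewrite /f (m1_balance sP).
  have vi : v != i by apply: contraNneq iS => <-.
  have ivE : [set i; v] \notin E.
    apply: contra iS => ivE; have clv := clS v vS; rewrite !inE in vS *.
    apply: connect_trans vS (connect1 _).
    by rewrite class_adj_sym /class_adj /adj ivE clv eqxx.
  rewrite (negPf vi) (negPf ivE).
  have ivN : [set i; v] \in non_edges E by rewrite inE cards2 (eq_sym i v) vi ivE.
  have [] := m1_non_edge sP (cl i) ivN.
  rewrite !yE (clS v vS) eqxx; case: m1_xbar => //.
  by rewrite subr0 -subr_le0 addrK ler10.
move: inflow0; rewrite (eq_bigr (fun=> 1)) // sumr_const => /eqP.
rewrite pnatr_eq0 => /eqP/finset.cards0_eq S0.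
by have := finset.in_set0 j; rewrite -S0 inE connect0.
Qed.

Lemma ext_edges_vnode (n k : nat) (E : {set {set 'I_n}}) (u v : 'I_n) :
  ([set vnode k u; vnode k v] \in ext_edges k E) = ([set u; v] \in E).
Proof.
have vnode_inj : injective (@vnode n k) := @lshift_inj n k.
have -> : [set vnode k u; vnode k v] = @vnode n k @: [set u; v].
  by rewrite imsetU1 imset_set1.
rewrite inE mem_imset; last exact: imset_inj.
(* A root edge contains an artificial node, which is never in the image of [vnode]. *)
case: (_ \in E) => //=; apply/imset2P => -[w c _ _ /setP/(_ (anode n c))].
rewrite !inE eqxx orbT => /imsetP[x _ /eqP].
by rewrite eq_sym eq_lrshift.
Qed.

Lemma ext_edges_anode (n k : nat) (E : {set {set 'I_n}}) (v : 'I_n) (c : 'I_k) :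
  [set vnode k v; anode n c] \in ext_edges k E.
Proof. by rewrite inE; apply/orP; right; apply/imset2P; exists v c. Qed.

Lemma M2_class_connected (R : realType) (n k alpha : nat) (E : {set {set 'I_n}})
    (s : M2_solution R n k) (cl : 'I_n -> 'I_k) (i j : 'I_n) :
  (forall c, exists v, cl v = c) ->
  M2_feasible alpha E s -> (forall v c, m2_y s v c = (cl v == c)) ->
  cl i = cl j -> connect (class_adj E cl) i j.
Proof.
move=> cl_surj sP yE cl_ij.
have csym : connect_sym (class_adj E cl) by apply/sym_connect_sym/class_adj_sym.
(* [g c] is the unique node attached to root [c]. *)
have /choice[g gE] c := sum_indicator_eq1 (m2_root sP c).
(* A component [S] containing no [g c] would have total inflow at most 0, while its nodes demand
   [#|S|], which is positive. *)
have reach u : exists c, connect (class_adj E cl) u (g c).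
  pose S := [set v | connect (class_adj E cl) u v].
  have [/existsP[c guc]|/existsPn no_root] := boolP [exists c, g c \in S].
    by exists c; rewrite inE in guc.
  (* Only an upper bound is claimed: the constraints force the flow from an unattached root to be 0,
     but flow towards a root is merely nonnegative. *)
  have cut_le0 w v : [set w; vnode k v] \in ext_edges k E ->
      w \notin @vnode n k @: S -> v \in S ->
      m2_f s w (vnode k v) - m2_f s (vnode k v) w <= 0.
    move=> wvE wS vS; case: (split_ordP w) wvE wS => [w'|c] ->.
      rewrite -/(vnode k w') ext_edges_vnode => wvE.
      rewrite mem_imset; last exact: lshift_inj.
      move=> wS.
      have clw : cl w' != cl v.
        apply: contraNneq wS => clw; rewrite !inE in vS *.
        apply: connect_trans vS (connect1 _).
        by rewrite class_adj_sym /class_adj /adj wvE clw eqxx.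
      have x0 : m2_x s [set vnode k w'; vnode k v] = false.
        have := m2_diff_class sP wvE clw; rewrite !yE !eqxx.
        by case: m2_x => //; rewrite -natrD -natrD ler_nat.
      have := m2_capacity sP wvE; rewrite x0 mulr0; apply: le_trans.
      rewrite lerD2l; apply: (@le_trans _ _ 0); rewrite ?oppr_le0;
      by apply: (m2_flow_ge0 sP); rewrite ext_edges_vnode finset.setUC.
    rewrite -/(anode n c) => avE _.
    have x0 : m2_x s [set anode n c; vnode k v] = false.
      by rewrite gE; apply: contraNF (no_root c) => /eqP <-.
    have /andP[_] := m2_root_flow sP c v; rewrite x0 mulr0 => fav.
    rewrite subr_le0; apply: le_trans fav _; apply: (m2_flow_ge0 sP).
    exact: ext_edges_anode.
  have : \sum_(v in @vnode n k @: S) net_inflow (ext_edges k E) (m2_f s) v <= 0.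
    rewrite sum_net_inflow; apply: sumr_le0 => _ /imsetP[v vS ->].
    by apply: sumr_le0 => w /andP[wvE wS]; apply: cut_le0.
  rewrite big_imset /=; last by move=> ? ? _ _; apply: lshift_inj.
  under eq_bigr => v _ do rewrite (m2_balance sP).
  rewrite sumr_const lern0 => /eqP/finset.cards0_eq S0.
  by have := finset.in_set0 u; rewrite -S0 inE connect0.
have clg_surj c : exists c', cl (g c') = c.
  have [v <-] := cl_surj c; have [c' /connect_class_adj vc'] := reach v.
  by exists c'; rewrite vc'.
(* [cl \o g] is a surjection of the finite type ['I_k] onto itself, so its section [h] is bijective
   and each class contains [g c] for exactly one [c]. The roots reached from [i] and [j] therefore
   coincide. *)
have /choice[h hK] := clg_surj.
have hK' : cancel h (cl \o g) by [].
have [h' _ h'K] : bijective h := injF_bij (can_inj hK').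
have [[ci ici] [cj jcj]] := (reach i, reach j).
have : cl (g ci) = cl (g cj).
  by rewrite -(connect_class_adj ici) -(connect_class_adj jcj).
rewrite -(h'K ci) -(h'K cj) !hK => h'E.
rewrite -(h'K ci) h'E h'K in ici.
by apply: connect_trans ici _; rewrite csym.
Qed.

Theorem theorem3 (R : realType) (n : nat) (E : {set {set 'I_n}})
  (hE : edge_set E) (d : {set 'I_n} -> R)
  (hd : forall A : {set 'I_n}, A \in E -> 0 <= d A)
  (k alpha : nat) (hk : (2 <= k)%N) (halpha : (2 <= alpha)%N)
  (i j : 'I_n) (hij : ((beta R n k alpha)%:E <= path_dist R E i j)%E) :
  (forall c : 'I_k,
     valid (M := M1 E d k alpha)
       (fun s : M1_solution R n k =>
          (m1_y s i c)%:R + (m1_y s j c)%:R <= 1 :> R)) /\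
  (forall c : 'I_k,
     valid (M := M2 E d k alpha)
       (fun s : M2_solution R n k =>
          (m2_y s i c)%:R + (m2_y s j c)%:R <= 1 :> R)).
Proof.
(* Common to both models, with connectivity of the classes as a premise. Surjectivity of [cl] is
   passed on for the root count in the second model. *)
have far_apart (y : 'I_n -> 'I_k -> bool) c :
    (forall v, \sum_(c' < k) (y v c')%:R = 1 :> R) ->
    (forall c', alpha%:R <= \sum_(v < n) (y v c')%:R :> R) ->
    (forall cl, (forall v c', y v c' = (cl v == c')) ->
       (forall c', exists v, cl v = c') ->
       cl i = cl j -> connect (class_adj E cl) i j) ->
    (y i c)%:R + (y j c)%:R <= 1 :> R.
  move=> y1 y_ge y_conn; have [cl yE] := class_map y1.
  have cl_ge c' : (alpha <= #|[set v | cl v == c']|)%N.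
    by rewrite -(ler_nat R) -(card_class _ _ yE).
  have cl_surj c' : exists v, cl v = c'.
    have : (0 < #|[set v | cl v == c']|)%N.
      by apply: leq_trans (cl_ge c'); apply: ltnW.
    by case/card_gt0P => v; rewrite inE => /eqP; exists v.
  rewrite !yE; case: eqP => [cli|_]; case: eqP => [clj|_]; rewrite ?addr0 ?add0r //.
  have ij : connect (class_adj E cl) i j by apply: y_conn; rewrite ?cli ?clj.
  by have := connected_class_dist R cl_ge ij; rewrite ltNge hij.
split=> c s /= sP.
  apply: far_apart (m1_assign sP) (m1_size sP) _ => cl yE _.
  exact: M1_class_connected sP yE.
(* The class size bound is implicit here: summing [alpha * x <= f] over the edges at root [c'],
   where the [x] add up to 1, bounds the supply, which equals the class size. *)
have m2_size c' : alpha%:R <= \sum_(v < n) (m2_y s v c')%:R :> R.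
  rewrite -(m2_supply sP) -[leLHS]mulr1 -[X in _ * X](m2_root sP c') mulr_sumr.
  by apply: ler_sum => v _; have /andP[] := m2_root_flow sP c' v.
apply: far_apart (m2_assign sP) m2_size _ => cl yE cl_surj.
exact: M2_class_connected cl_surj sP yE.
Qed.
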